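(* Let $\mathbb{L}(\mathcal{A})$ and $\mathbb{L}(\mathcal{B})$ be two $n$-dimensional lattices with lattice bases $\mathcal{A},\mathcal{B}\in\mathbb{R}^{n\times n}$. If there exists a nonzero $r\in\mathbb{Z}$ such that $M=r\mathcal{A}^{-1}\mathcal{B}\in\mathbb{Z}^{n\times n}$, then there is a lattice $\mathbb{L}(\mathcal{C})$ with $\mathbb{L}(\mathcal{C})\subset\mathbb{L}(\mathcal{A})$ and $\mathbb{L}(\mathcal{C})\subset\mathbb{L}(\mathcal{B})$ and with $|\det(\mathcal{C})|$ as small as possible (among all $n$-dimensional lattices contained in both $\mathbb{L}(\mathcal{A})$ and $\mathbb{L}(\mathcal{B})$). A lattice basis of $\mathbb{L}(\mathcal{C})$ is given by $$\mathcal{C}=\mathcal{B}T^{-1}N_{\mathcal{B}},$$ where $N_{\mathcal{B}}$ is the diagonal matrix with $(N_{\mathcal{B}})_{i,i}:=r\cdot\gcd(r,s_i)^{-1}$, and $S=V^{-1}MT^{-1}=\operatorname{diag}(s_1,\ldots,s_n)$, with $V,T\in\mathbb{Z}^{n\times n}$ unimodular, is the Smith normal form of $M$.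
   Context: A lattice basis is an invertible matrix $\mathcal{A}\in\mathbb{R}^{n\times n}$; its $n$-dimensional lattice is $\mathbb{L}(\mathcal{A})=\mathcal{A}\mathbb{Z}^n$. A matrix $U\in\mathbb{Z}^{n\times n}$ is unimodular if $\det U\in\{\pm1\}$. A matrix is in Smith normal form if it is diagonal with diagonal entries $s_i$ satisfying $s_{i+1}/s_i\in\mathbb{Z}$ for all $i=1,\ldots,n-1$. $\gcd$ denotes the (positive) greatest common divisor. *)

(* Defs.v *)
From mathcomp Require Import all_boot all_order all_algebra.
From mathcomp Require Import classical_sets reals.

Set Implicit Arguments.
Unset Strict Implicit.
Unset Printing Implicit Defensive.

Import Order.TTheory GRing.Theory Num.Theory.
Local Open Scope classical_set_scope.
Local Open Scope ring_scope.

Definition int_to_real_mx (R : realType) (m n : nat) (M : 'M[int]_(m, n)) :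
  'M[R]_(m, n) := map_mx (fun z : int => z%:~R) M.

(* The matrix is a lattice basis only when it is in [unitmx]; vectors are
   columns, so this is A Z^n. *)
Definition lattice (R : realType) (n : nat) (A : 'M[R]_n) : set 'cV[R]_n :=
  [set A *m int_to_real_mx R z | z in [set: 'cV[int]_n]].

Definition unimodular (n : nat) (U : 'M[int]_n) : Prop :=
  \det U = 1 \/ \det U = -1.

(* The integrality of s_{i+1} / s_i is read as divisibility, which also makes
   sense when s_i = 0. No sign is imposed on the entries. *)
Definition smith_normal (n : nat) (S : 'M[int]_n) : Prop :=
  is_diag_mx S /\
  forall i j : 'I_n, j = i.+1 :> nat -> (S i i %| S j j)%Z.

(* On [unitmx], [invmx] over [int] is the inverse, which is again an integer
   matrix. *)
Definition smith_decomposition (n : nat) (M V T S : 'M[int]_n) : Prop :=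
  [/\ unimodular V, unimodular T, S = invmx V *m M *m invmx T
    & smith_normal S].

Definition smallest_common_sublattice (R : realType) (n : nat)
    (A B C : 'M[R]_n) : Prop :=
  [/\ C \in unitmx,
      lattice C `<=` lattice A,
      lattice C `<=` lattice B
    & forall C' : 'M[R]_n, C' \in unitmx ->
        lattice C' `<=` lattice A -> lattice C' `<=` lattice B ->
        `|\det C| <= `|\det C'| ].

(* [gcdz] is the nonnegative gcd, hence positive when r != 0. *)
Definition NB (R : realType) (n : nat) (r : int) (S : 'M[int]_n) : 'M[R]_n :=
  diag_mx (\row_i (r%:~R * (gcdz r (S i i))%:~R^-1)).

(* Main.v *)
(* After the unimodular changes of basis A V and B T^-1, the relation
   r B = A M becomes r b_i = s_i a_i on basis vectors. A vector with integer
   coordinates w_i in the basis b lies in the lattice of A iff r divides every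
   s_i w_i, i.e. iff r / gcd(r, s_i) divides w_i. So C generates exactly the
   intersection of the two lattices; any other common sublattice of full rank
   is contained in it, hence its determinant is that of C times a nonzero
   integer. *)
Require Import Defs.
From mathcomp Require Import all_boot all_order all_algebra.
From mathcomp Require Import classical_sets reals.

Import Order.TTheory GRing.Theory Num.Theory.
Local Open Scope classical_set_scope.
Local Open Scope ring_scope.

Lemma int_to_real_mxM (R : realType) (m n p : nat) (M : 'M[int]_(m, n))
    (N : 'M[int]_(n, p)) :
  int_to_real_mx R (M *m N) = int_to_real_mx R M *m int_to_real_mx R N.
Proof. exact: (map_mxM (intmul (1 : R))). Qed.

Lemma int_to_real_mxZ (R : realType) (m n : nat) (r : int)
    (M : 'M[int]_(m, n)) :
  int_to_real_mx R (r *: M) = r%:~R *: int_to_real_mx R M.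
Proof. exact: (map_mxZ (intmul (1 : R))). Qed.

Lemma int_to_real_mx1 (R : realType) (n : nat) :
  int_to_real_mx R (1%:M : 'M_n) = 1%:M.
Proof. exact: (map_mx1 (intmul (1 : R))). Qed.

Lemma det_int_to_real_mx (R : realType) (n : nat) (M : 'M[int]_n) :
  \det (int_to_real_mx R M) = (\det M)%:~R.
Proof. exact: (det_map_mx (intmul (1 : R))). Qed.

Lemma int_to_real_mx_inj (R : realType) (m n : nat) :
  injective (@int_to_real_mx R m n).
Proof.
move=> M N /matrixP eqMN; apply/matrixP => i j.
by have := eqMN i j; rewrite !mxE => /intr_inj.
Qed.

Lemma int_to_real_mx_unit (R : realType) (n : nat) (U : 'M[int]_n) :
  U \in unitmx -> int_to_real_mx R U \in unitmx.
Proof.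
move=> hU; have : int_to_real_mx R U *m int_to_real_mx R (invmx U) = 1%:M.
  by rewrite -int_to_real_mxM mulmxV // int_to_real_mx1.
by case/mulmx1_unit.
Qed.

Lemma unimodularP (n : nat) (U : 'M[int]_n) : unimodular U <-> U \in unitmx.
Proof.
rewrite unitmxE; split=> [[]->|]; rewrite ?unitr1 ?unitrN1 //.
by case/orP => /eqP; [left|right].
Qed.

Lemma lattice_mulmx_sub (R : realType) (n : nat) (A : 'M[R]_n)
    (Z : 'M[int]_n) : lattice (A *m int_to_real_mx R Z) `<=` lattice A.
Proof.
move=> _ [z _ <-]; exists (Z *m z) => //.
by rewrite int_to_real_mxM mulmxA.
Qed.

(** Each column of [C] is the image of a standard basis vector, so it lies in [lattice C]; its
    integer coordinates with respect to [A] form the corresponding column of [Z]. *)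
Lemma lattice_subP (R : realType) (n : nat) (C A : 'M[R]_n) :
  lattice C `<=` lattice A -> exists Z : 'M[int]_n, C = A *m int_to_real_mx R Z.
Proof.
move=> sCA.
have /fin_all_exists [z hz] (j : 'I_n) :
    exists z : 'cV[int]_n, A *m int_to_real_mx R z = col j C.
  have [|z _ hz] := sCA (col j C); last by exists z.
  exists (delta_mx j 0) => //.
  by rewrite /int_to_real_mx (map_delta_mx (intmul (1 : R))) -colE.
exists (\matrix_(i, j) z j i 0); apply/matrixP => i j.
have /matrixP/(_ i 0) := hz j; rewrite !mxE => <-.
by apply: eq_bigr => k _; rewrite !mxE.
Qed.

Lemma lattice_mulmx_unit (R : realType) (n : nat) (A : 'M[R]_n)
    (U : 'M[int]_n) : U \in unitmx ->
  lattice (A *m int_to_real_mx R U) = lattice A.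
Proof.
move=> hU; apply/seteqP; split; first exact: lattice_mulmx_sub.
have {1}-> : A = A *m int_to_real_mx R U *m int_to_real_mx R (invmx U).
  by rewrite -mulmxA -int_to_real_mxM mulmxV // int_to_real_mx1 mulmx1.
exact: lattice_mulmx_sub.
Qed.

(** Writing [C = A Z] with [Z] integral, invertibility of [C] makes [\det Z] a nonzero integer, of
    absolute value at least 1. *)
Lemma lattice_sub_det (R : realType) (n : nat) (C A : 'M[R]_n) :
  C \in unitmx -> lattice C `<=` lattice A -> `|\det A| <= `|\det C|.
Proof.
move=> hC /lattice_subP [Z eqC]; move: hC.
rewrite eqC unitmxE det_mulmx det_int_to_real_mx unitfE mulf_eq0 negb_or.
case/andP=> _; rewrite intr_eq0 => detZ_neq0.
by rewrite normrM ler_peMr // -intr_norm ler1z -gtz0_ge1 normr_gt0.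
Qed.

Lemma smallest_common_sublattice_cap (R : realType) (n : nat)
    (A B C : 'M[R]_n) : C \in unitmx -> lattice C = lattice A `&` lattice B ->
  smallest_common_sublattice A B C.
Proof.
move=> hC eqC; split=> //; first by rewrite eqC => x [].
  by rewrite eqC => x [].
move=> C' hC' sA sB; apply: lattice_sub_det => // x C'x.
by rewrite eqC; split; [apply: sA|apply: sB].
Qed.

Lemma NB_int (R : realType) (n : nat) (r : int) (S : 'M[int]_n) : r != 0 ->
  NB R r S = int_to_real_mx R (diag_mx (\row_i (r %/ gcdz r (S i i))%Z)).
Proof.
move=> hr; rewrite /int_to_real_mx (map_diag_mx (intmul (1 : R))).
congr diag_mx; apply/rowP => i; rewrite !mxE.
have g_neq0 : gcdz r (S i i) != 0 by rewrite gcdz_eq0 (negPf hr).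
rewrite -{1}(divzK (dvdz_gcdl r (S i i))) intrM mulfK //.
by rewrite intr_eq0.
Qed.

Lemma NB_unit (R : realType) (n : nat) (r : int) (S : 'M[int]_n) : r != 0 ->
  NB R r S \in unitmx.
Proof.
move=> hr; rewrite unitmxE det_diag unitfE; apply/prodf_neq0 => i _.
by rewrite mxE mulf_neq0 ?invr_eq0 ?intr_eq0 // gcdz_eq0 (negPf hr).
Qed.

Lemma dvdz_divgcd (r s w u : int) : r != 0 -> r * u = s * w ->
  ((r %/ gcdz r s)%Z %| w)%Z.
Proof.
move=> hr eq_ru; have g_neq0 : gcdz r s != 0 by rewrite gcdz_eq0 (negPf hr).
have [a [b eq_g]] := Bezoutz r s.
(* With g = a r + b s the gcd, g w = a r w + b s w = r (a w + b u); dividing by g gives this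
   cofactor. *)
apply/dvdzP; exists (a * w + b * u); apply: (mulIf g_neq0).
rewrite -mulrA (divzK (dvdz_gcdl r s)) -eq_g mulrDr mulrDl.
rewrite mulrCA mulrA; congr (_ + _).
by rewrite mulrCA [w * s]mulrC -eq_ru [r * u]mulrC mulrA.
Qed.

(** This is the diagonal case, where membership in the intersection can be tested one coordinate at
    a time. *)
Lemma lattice_NB (R : realType) (n : nat) (A B : 'M[R]_n) (r : int)
    (S : 'M[int]_n) : A \in unitmx -> r != 0 -> is_diag_mx S ->
    r%:~R *: B = A *m int_to_real_mx R S ->
  lattice (B *m NB R r S) = lattice A `&` lattice B.
Proof.
move=> hA hr /diag_mxP [d ->]; set D := diag_mx d => eqB.
have r_neq0 : r%:~R != 0 :> R by rewrite intr_eq0.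
rewrite NB_int //; set N := diag_mx _; apply/seteqP; split; last first.
  move=> x [[u _ eq_xu] [w _ eq_xw]].
  (* Both sides are the coordinates of r x in the basis [A]. *)
  have eq_uw : r *: u = D *m w.
    apply: (@int_to_real_mx_inj R); rewrite int_to_real_mxZ int_to_real_mxM.
    apply: (can_inj (mulKmx hA)).
    by rewrite mulmxA -eqB -scalemxAl eq_xw -eq_xu scalemxAr.
  exists (\col_i ((w i 0)%R %/ (r %/ gcdz r (D i i))%Z)%Z) => //.
  rewrite -mulmxA -int_to_real_mxM -eq_xw; congr (_ *m int_to_real_mx R _).
  apply/colP => i; rewrite mul_diag_mx !mxE mulrC divzK //.
  apply: (@dvdz_divgcd _ _ _ (u i 0)) => //.
  by have /colP/(_ i) := eq_uw; rewrite mul_diag_mx !mxE eqxx.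
move=> x Cx; split; last exact: lattice_mulmx_sub Cx.
(* The integer coordinates of [B N] in the basis [A]: r B N = A D N = r A Q, because s (r / g) = r
   (s / g) for g = gcd(r, s). *)
pose Q := diag_mx (\row_i ((d 0 i)%R %/ gcdz r (D i i))%Z).
have eqDN : D *m N = r *: Q.
  rewrite mulmx_diag -linearZ; congr diag_mx; apply/rowP => i; rewrite !mxE.
  by rewrite eqxx mulr1n mulz_divCA_gcd.
suff eqBN : B *m int_to_real_mx R N = A *m int_to_real_mx R Q.
  by rewrite eqBN in Cx; apply: lattice_mulmx_sub Cx.
apply: (scalerI r_neq0); rewrite scalemxAl eqB -mulmxA -int_to_real_mxM eqDN.
by rewrite int_to_real_mxZ scalemxAr.
Qed.

Lemma smith_decomposition_ex (n : nat) (M : 'M[int]_n) :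
  exists V T S : 'M[int]_n, smith_decomposition M V T S.
Proof.
have [V hV [T hT [d d_sorted eqM]]] := int_Smith_normal_form M.
exists V, T, (\matrix_(i, j) (d`_i *+ (i == j :> nat))).
split; [exact/unimodularP | exact/unimodularP | |].
  by rewrite eqM -!mulmxA mulmxV // mulmx1 mulKmx.
split=> [|i j eq_ji].
  by apply/is_diag_mxP => i j neq_ij; rewrite mxE (negPf neq_ij).
rewrite !mxE !eqxx !mulr1n eq_ji.
(* Past the end of [d] the diagonal entry is the default 0, which every integer divides. *)
case: (ltnP i.+1 (size d)) => [lt_id | le_di]; last by rewrite nth_default.
by have /(sortedP 0) := d_sorted; apply.
Qed.

Theorem theorem5p1 (R : realType) (n : nat) (A B : 'M[R]_n)
    (hA : A \in unitmx) (hB : B \in unitmx)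
    (r : int) (hr : r != 0)
    (M : 'M[int]_n) (hM : int_to_real_mx R M = r%:~R *: (invmx A *m B)) :
  exists C : 'M[R]_n,
    [/\ smallest_common_sublattice A B C,
        (exists V T S : 'M[int]_n, smith_decomposition M V T S)
      & forall V T S : 'M[int]_n, smith_decomposition M V T S ->
          let C0 := B *m int_to_real_mx R (invmx T) *m NB R r S in
          smallest_common_sublattice A B C0 /\ lattice C0 = lattice C].
Proof.
(* Every decomposition yields a basis of the same intersection; hence the resulting lattice does not
   depend on the choice of [V], [T], [S]. *)
have key V T S : smith_decomposition M V T S ->
    let C0 := B *m int_to_real_mx R (invmx T) *m NB R r S in
    C0 \in unitmx /\ lattice C0 = lattice A `&` lattice B.
  case=> /unimodularP hV /unimodularP hT eqS [diagS _] C0.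
  have hT' : invmx T \in unitmx by rewrite unitmx_inv.
  split; first by rewrite !unitmx_mul hB int_to_real_mx_unit // NB_unit.
  (* Passing to the bases [A V] and [B T^-1] keeps both lattices and reduces to the diagonal case,
     since A V S = A M T^-1 = r B T^-1. *)
  rewrite -(lattice_mulmx_unit _ _ A V hV) -(lattice_mulmx_unit _ _ B _ hT').
  apply: lattice_NB => //; first by rewrite unitmx_mul hA int_to_real_mx_unit.
  rewrite -mulmxA -int_to_real_mxM eqS !mulmxA mulmxV // mul1mx.
  by rewrite int_to_real_mxM hM -scalemxAl -scalemxAr !mulmxA mulmxV // mul1mx
    scalemxAl.
have [V0 [T0 [S0 dec0]]] := smith_decomposition_ex n M.
have [C_unit C_cap] := key _ _ _ dec0.
exists (B *m int_to_real_mx R (invmx T0) *m NB R r S0); split.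
- exact: smallest_common_sublattice_cap.
- by exists V0, T0, S0.
move=> V T S /key [C0_unit C0_cap] C0; split.
  exact: smallest_common_sublattice_cap.
by rewrite C0_cap C_cap.
Qed.
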